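(* Let $(X,\tau)$ be a topological space. Then $(X,\tau)$ is connected if and only if $(X,{}^{*}O(X))$ is connected.
   Context: For a topological space $(X,\tau)$, a set $U\subseteq X$ is called regular open if $\mathrm{int}(\mathrm{cl}(U))=U$; the collection of all regular open subsets is denoted $R.O(X)$. A set $A\subseteq X$ is called $*$-open if for every $x\in A$ there exists $U\in R.O(X)$ with $x\in U\subseteq A$. The collection of all $*$-open subsets of $(X,\tau)$ is denoted ${}^{*}O(X)$; it is a topology on $X$. *)

(* Defs.v *)
From HB Require Import structures.
From mathcomp Require Import all_boot all_classical.
From mathcomp Require Export topology_structure connected.

Set Implicit Arguments.
Unset Strict Implicit.
Unset Printing Implicit Defensive.

Local Open Scope classical_set_scope.

Definition star_open (X : topologicalType) (A : set X) : Prop :=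
  forall x, A x -> exists U : set X, [/\ regopen U, U x & U `<=` A].

(* The carrier of [X], as a separate constant so that it can bear the topology
   whose open sets are the *-open sets of [X]. *)
Definition star_topology (X : topologicalType) : Type := X.

Section StarTopology.
Variable X : topologicalType.

HB.instance Definition _ := Choice.on (star_topology X).

Lemma regopenT : regopen [set: X].
Proof. by rewrite /regopen closureT interiorT. Qed.

Lemma regopenI (A B : set X) : regopen A -> regopen B -> regopen (A `&` B).
Proof.
move=> rA rB; rewrite /regopen eqEsubset; split.
  rewrite -[X in _ `<=` X `&` _]rA -[X in _ `<=` _ `&` X]rB subsetI; split.
    by apply/interiorS/closureS; exact: subIsetl.
  by apply/interiorS/closureS; exact: subIsetr.
have oAB : open (A `&` B).
  by apply: openI; [rewrite -rA|rewrite -rB]; exact: open_interior.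
by rewrite -open_subsetE//; exact: subset_closure.
Qed.

Lemma star_openT : star_open [set: X].
Proof. by move=> x _; exists setT; split=> //; exact: regopenT. Qed.

Lemma star_openI : setI_closed (@star_open X).
Proof.
move=> A B oA oB x [/oA[U [rU Ux UA]] /oB[V [rV Vx VB]]].
by exists (U `&` V); split; [exact: regopenI|split|exact: setISS].
Qed.

Lemma star_open_bigU (I : Type) (f : I -> set X) :
  (forall i, star_open (f i)) -> star_open (\bigcup_i f i).
Proof.
move=> of_ x [i _ /of_[U [rU Ux Uf]]]; exists U; split=> //.
by move=> y /Uf fy; exists i.
Qed.

HB.instance Definition _ := isOpenTopological.Build (star_topology X)
  star_openT star_openI star_open_bigU.

Lemma open_star_topologyE : @open (star_topology X) = @star_open X.
Proof. by []. Qed.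

End StarTopology.

(* Main.v *)
(** Every *-open set is open, while a clopen set is regular open and hence
    *-open, as is its complement.  So both topologies have the same clopen sets,
    and connectedness only depends on these. *)
Require Import Defs.
From mathcomp Require Import all_boot all_classical.
Local Open Scope classical_set_scope.

(** [connected] speaks of traces of an open and of a closed set; on the whole space each trace is
    the set itself. *)
Lemma connected_setTP (X : topologicalType) :
  connected [set: X] <-> forall B : set X, B !=set0 -> clopen B -> B = [set: X].
Proof.
split=> [cX B B0 [oB cB]|cX B B0 [C oC BC] [D cD BD]].
  by apply: cX => //; exists B; rewrite ?setTI.
by apply: cX => //; split; [rewrite BC setTI|rewrite BD setTI].
Qed.

Lemma regopen_open (X : topologicalType) (A : set X) : regopen A -> open A.
Proof. by move=> <-; exact: open_interior. Qed.

Lemma clopen_regopen (X : topologicalType) (A : set X) : clopen A -> regopen A.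
Proof. by move=> [/interior_id oA /closure_id cA]; rewrite /regopen -cA. Qed.

Lemma star_open_open (X : topologicalType) (A : set X) : star_open A -> open A.
Proof.
move=> oA; rewrite openE => x /oA[U [/regopen_open oU Ux UA]].
by rewrite /interior nbhsE; exists U => //; split.
Qed.

Lemma clopen_star_open (X : topologicalType) (A : set X) :
  clopen A -> star_open A.
Proof. by move=> /clopen_regopen rA x Ax; exists A; split. Qed.

Lemma clopen_star_topology (X : topologicalType) (A : set X) :
  @clopen (star_topology X) A <-> @clopen X A.
Proof.
split=> [[oA]|cA].
  (* Closedness is read as openness of the complement, so only open sets need comparing. *)
  by rewrite -openC => oAC; split; [|rewrite -openC]; exact: star_open_open.
split; first exact: clopen_star_open.
by rewrite -openC; apply: clopen_star_open; exact: clopenC.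
Qed.

Theorem lemma17 (X : topologicalType) :
  connected [set: X] <-> connected [set: star_topology X].
Proof.
rewrite !connected_setTP.
(* [star_topology X] unfolds to [X], so both sides range over the same sets [B] and differ only in
   [clopen]. *)
by split=> cX B B0 /clopen_star_topology; exact: cX.
Qed.
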